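(* Suppose $\mathbb{R}^n$ and $\mathbb{R}^m$ are endowed with (arbitrary) norms, both denoted $\|\cdot\|$. Let $A\in\mathbb{R}^{m\times n}$, let $g:\mathbb{R}^m\to\mathbb{R}\cup\{\infty\}$ be a convex differentiable function, and let $f=g\circ A$. Let $X\subseteq\mathbb{R}^n$ be a polyhedron with $X\subseteq\mathrm{dom}(f)$ such that $A(X)$ contains more than one point. Let $D:X\times X\to\mathbb{R}_+$ be a distance-like function with $D(x,y)\le\frac12\|x-y\|^2$ for all $x,y\in X$. If $g$ is $\mu_g$-strongly convex for the norm in $\mathbb{R}^m$ then \[ \mu_{f,X,D}\ \ge\ \min_{C\in\mathcal{T}(A|X)}\frac{\mu_g}{\|(A|C)^{-1}\|^2}. \]
   Context: Distance-like: $D(y,x)\ge 0$ and $D(x,x)=0$ for all $x,y\in X$. Bregman distance: $D_f(y,x)=f(y)-f(x)-\langle\nabla f(x),y-x\rangle$. For nonempty $S\subseteq X$, $D_f(S,x):=\inf_{y\in S}D_f(y,x)$ and $D(S,x):=\inf_{y\in S}D(y,x)$. For $y\in X$, $Z_{f,X}(y):=\{x\in X: f(x)=f(y)\text{ and }\langle\nabla f(x)-\nabla f(y),x-y\rangle=0\}$. The relative strong convexity constant is \[ \mu_{f,X,D}:=\sup\{\mu\ge0:\ D_f(Z_{f,X}(y),x)\ge\mu\,D(Z_{f,X}(y),x)\text{ for all }x,y\in X\}. \] $g$ is $\mu_g$-strongly convex for $\|\cdot\|$ (with $\mu_g>0$) if $D_g(v,u)\ge\frac{\mu_g}{2}\|v-u\|^2$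 for all $u,v\in\mathrm{dom}(g)$. For a convex cone $C\subseteq\mathbb{R}^n$, \[ \|(A|C)^{-1}\|:=\sup_{v\in A(C),\,\|v\|\le1}\ \inf_{x\in C,\,Ax=v}\|x\|. \] Tangent cones: for $x\in X$, $T_X(x):=\{d\in\mathbb{R}^n: x+td\in X\text{ for some }t>0\}$, and $\mathcal{T}(X):=\{T_X(x):x\in X\}$ (a finite set). $\mathcal{T}(A|X)$ is the set of those $C\in\mathcal{T}(X)$ such that $A(C)$ is a linear subspace and $C$ is minimal with respect to inclusion among the cones in $\mathcal{T}(X)$ with this property. *)

(* Defs.v *)
From HB Require Import structures.
From mathcomp Require Import all_boot all_order all_algebra.
From mathcomp Require Import all_classical all_reals all_analysis.
Import Order.TTheory GRing.Theory Num.Theory numFieldNormedType.Exports.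

Set Implicit Arguments.
Unset Strict Implicit.
Unset Printing Implicit Defensive.

Local Open Scope classical_set_scope.
Local Open Scope ring_scope.

(* Vectors of R^n are column vectors 'cV[R]_n. The norm and topology that the
   library puts on 'cV[R]_n are used only for differentiability; the norms of
   the theorem are arbitrary functions satisfying is_norm. *)

Section Defs.
Variable R : realType.

Section Functions.
Variable n : nat.
Implicit Types (f : 'cV[R]_n -> \bar R) (N : 'cV[R]_n -> R) (u v x y : 'cV[R]_n).

(* N x >= 0 and N 0 = 0 follow. *)
Definition is_norm N : Prop :=
  [/\ forall x y, N (x + y) <= N x + N y,
      forall (a : R) x, N (a *: x) = `|a| * N x
    & forall x, N x = 0 -> x = 0].

Definition dot u v : R := (u^T *m v) 0 0.

Definition edom f : set 'cV[R]_n := [set x | (f x < +oo)%E].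

(* With 0 * +oo = 0, the cases t = 0 and t = 1 hold trivially. *)
Definition econvex f : Prop :=
  forall x y (t : R), 0 <= t <= 1 ->
    (f (t *: x + (1 - t) *: y)%R
       <= t%:E * f x + (1 - t)%:E * f y)%E.

(* f is finite around every point of its domain, and (Frechet) differentiable
   there; in particular the domain is open. *)
Definition edifferentiable f : Prop :=
  forall x, edom f x ->
    (\forall z \near x, f z \is a fin_num) /\ differentiable (fine \o f) x.

(* The vector of partial derivatives. *)
Definition grad f x : 'cV[R]_n :=
  \col_(i < n) 'D_(delta_mx i 0) (fine \o f) x.

(* Meaningful for x and y in edom f only. *)
Definition bregman f y x : \bar R :=
  (f y - f x - (dot (grad f x) (y - x)%R)%:E)%E.

Definition strongly_convex N f (mu : R) : Prop :=
  0 < mu /\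
  forall u v, edom f u -> edom f v ->
    ((mu / 2 * N (v - u) ^+ 2)%:E <= bregman f v u)%E.

End Functions.

Section RelativeConstant.
Variable n : nat.
Implicit Types (f : 'cV[R]_n -> \bar R) (X S : set 'cV[R]_n).
Implicit Types (D : 'cV[R]_n -> 'cV[R]_n -> R) (x y : 'cV[R]_n).

Definition distance_like X D : Prop :=
  (forall x y, X x -> X y -> 0 <= D y x) /\ (forall x, X x -> D x x = 0).

Definition bregman_set f S x : \bar R :=
  ereal_inf [set bregman f y x | y in S].

Definition dist_set D S x : \bar R :=
  ereal_inf [set (D y x)%:E | y in S].

Definition Zset f X y : set 'cV[R]_n :=
  [set x | [/\ X x, f x = f y & dot (grad f x - grad f y) (x - y) = 0]].

(* The supremum is taken in the extended reals: it may be +oo. *)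
Definition rel_strong_convexity f X D : \bar R :=
  ereal_sup [set mu%:E | mu in [set mu : R | 0 <= mu /\
    forall x y, X x -> X y ->
      (mu%:E * dist_set D (Zset f X y) x
         <= bregman_set f (Zset f X y) x)%E]].

End RelativeConstant.

Section Cones.
Variable n : nat.
Implicit Types (X C : set 'cV[R]_n) (x d : 'cV[R]_n).

Definition polyhedron X : Prop :=
  exists (k : nat) (B : 'M[R]_(k, n)) (b : 'cV[R]_k),
    X = [set x | forall i, (B *m x) i 0 <= b i 0].

Definition tangent_cone X x : set 'cV[R]_n :=
  [set d | exists2 t : R, 0 < t & X (x + t *: d)].

Definition tangent_cones X : set (set 'cV[R]_n) :=
  [set tangent_cone X x | x in X].

Definition linear_subspace C : Prop :=
  C 0 /\ forall (a : R) x y, C x -> C y -> C (a *: x + y).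

End Cones.

Section RelativeCones.
Variables m n : nat.
Variable A : 'M[R]_(m, n).

Definition minimal_tangent_cones (X : set 'cV[R]_n) : set (set 'cV[R]_n) :=
  [set C | [/\ tangent_cones X C, linear_subspace (mulmx A @` C)
    & forall C', tangent_cones X C' -> linear_subspace (mulmx A @` C') ->
        C' `<=` C -> C' = C]].

(* Nn is the norm of R^n and Nm that of R^m. *)
Definition inv_norm (Nn : 'cV[R]_n -> R) (Nm : 'cV[R]_m -> R)
    (C : set 'cV[R]_n) : \bar R :=
  ereal_sup [set ereal_inf [set (Nn x)%:E | x in [set x | C x /\ A *m x = v]]
            | v in [set v | (mulmx A @` C) v /\ Nm v <= 1]].

End RelativeCones.

Definition is_min (S : set (\bar R)) (z : \bar R) : Prop :=
  S z /\ lbound S z.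

End Defs.

(* Main.v *)
(** By strong convexity, Z_{f,X}(y) is the fibre {z in X | A z = A y} and
    D_f(Z_{f,X}(y), x) >= mu_g/2 |A y - A x|^2, so the theorem reduces to a
    Hoffman bound: x is within h |A y - A x| of that fibre as soon as h bounds
    |(A|C)^{-1}| for every C in T(A|X).

    Call z internal in X if every segment of X ending at z can be prolonged in X
    beyond z. Suppose first that y is internal, and let z be a point of the
    fibre nearest to x. As A z = A y is internal in A(X), the image under A of
    K = T_X(z) is a linear subspace, so K contains some C in T(A|X). A(C) is a
    linear subspace containing A(y - x), so there is p in C with
    A p = A(y - x) and |p| at most about h |A(y - x)|. Then (x - z) + p lies in
    K and in ker A; moving z a little in that direction stays in the fibre, and
    brings z closer to x if |p| < |z - x|. For arbitrary x and y, contract both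
    towards an internal point and pass to the limit by compactness. *)

Require Import Defs.
From HB Require Import structures.
From mathcomp Require Import all_boot all_order all_algebra.
From mathcomp Require Import all_classical all_reals all_analysis.
From mathcomp Require Import ring lra.
Import Order.TTheory GRing.Theory Num.Theory numFieldNormedType.Exports.

Set Implicit Arguments.
Unset Strict Implicit.
Unset Printing Implicit Defensive.

Local Open Scope classical_set_scope.
Local Open Scope ring_scope.

(** * Compactness of bounded closed sets of column vectors *)

Lemma norm_trmx (R : realType) m n (u : 'M[R]_(m, n)) : `|u^T| = `|u|.
Proof.
have le_trmx p q (v : 'M[R]_(p, q)) : `|v^T| <= `|v|.
  rewrite [leLHS]mx_normrE [leRHS]mx_normrE.
  apply/bigmax_leP; split=> [|ij _]; first exact: bigmax_ge_id.
  rewrite mxE.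
  exact: (le_bigmax _ (fun ij : 'I_p * 'I_q => `|v ij.1 ij.2|) (ij.2, ij.1)).
by apply/le_anti; rewrite le_trmx -{1}[u]trmxK le_trmx.
Qed.

Lemma trmx_continuous (R : realType) m n :
  continuous (fun u : 'M[R]_(m, n) => u^T).
Proof.
move=> u B /= /nbhs_ballP[e e0 eB]; apply/nbhs_ballP; exists e => // v uv.
by apply: eB; move: uv; rewrite -!ball_normE /= -linearB/= norm_trmx.
Qed.

(** Transposition is continuous and preserves the entrywise sup norm, so the statement for row
    vectors carries over. *)
Lemma bounded_closed_compact_cV (R : realType) n (S : set 'cV[R]_n) :
  bounded_set S -> closed S -> compact S.
Proof.
move=> [M [Mreal SM]] Scl.
have -> : S = trmx @` (trmx @^-1` S : set 'rV[R]_n).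
  apply/seteqP; split=> [x Sx|_ [u Su <-]//].
  by exists x^T; rewrite /= trmxK.
apply: continuous_compact.
  by apply: continuous_subspaceT; exact: trmx_continuous.
apply: bounded_closed_compact.
  by exists M; split=> // a Ma u Su /=; rewrite -norm_trmx; exact: SM Su.
by apply: preimage_closed => // u _; exact: trmx_continuous.
Qed.

(** * Arbitrary norms compared with the sup norm *)

Section Norms.
Variables (R : realType) (n : nat).
Implicit Types (N : 'cV[R]_n -> R) (x y z : 'cV[R]_n).

Definition is_seminorm N : Prop :=
  (forall x y, N (x + y) <= N x + N y) /\
  (forall (a : R) x, N (a *: x) = `|a| * N x).

Lemma is_norm_seminorm N : is_norm N -> is_seminorm N.
Proof. by case. Qed.

Lemma seminorm0 N : is_seminorm N -> N 0 = 0.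
Proof. by case=> _ hN; rewrite -(scale0r 0) hN normr0 mul0r. Qed.

Lemma seminormN N x : is_seminorm N -> N (- x) = N x.
Proof. by case=> _ hN; rewrite -scaleN1r hN normrN1 mul1r. Qed.

Lemma seminormBC N x y : is_seminorm N -> N (x - y) = N (y - x).
Proof. by move=> sN; rewrite -seminormN// opprB. Qed.

Lemma seminorm_ge0 N x : is_seminorm N -> 0 <= N x.
Proof.
move=> sN; have [tN _] := sN; have := tN x (- x).
by rewrite subrr seminorm0// seminormN// -mulr2n pmulrn_lge0.
Qed.

Lemma seminorm_dist N x y : is_seminorm N -> `|N x - N y| <= N (x - y).
Proof.
move=> sN; have [tN _] := sN.
have := tN (x - y) y; have := tN (y - x) x; rewrite !subrK.
rewrite (seminormBC y)// ler_norml => h1 h2.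
by apply/andP; split; lra.
Qed.

Lemma seminorm_le N : is_seminorm N ->
  exists2 M, 0 < M & forall x, N x <= M * `|x|.
Proof.
move=> sN; have [tN hN] := sN.
exists (1 + \sum_(i < n) N (delta_mx i 0)) => [|x].
  by rewrite ltr_pwDl// sumr_ge0// => i _; exact: seminorm_ge0.
apply: (@le_trans _ _ ((\sum_(i < n) N (delta_mx i 0)) * `|x|)); last first.
  by rewrite ler_wpM2r// lerDr.
rewrite [X in N X]matrix_sum_delta mulr_suml.
elim/big_rec2: _ => [|i a b _ ih]; first by rewrite seminorm0.
apply: le_trans (tN _ _) _; rewrite lerD// big_ord1 hN mulrC ler_wpM2l//.
  exact: seminorm_ge0.
rewrite [leRHS]mx_normrE.
exact: (le_bigmax _ (fun ij : 'I_n * 'I_1 => `|x ij.1 ij.2|) (i, 0)).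
Qed.

Lemma seminorm_lipschitz_continuous N (f : 'cV[R]_n -> R) :
  is_seminorm N -> (forall x y, `|f x - f y| <= N (x - y)) -> continuous f.
Proof.
move=> sN fN x B /= /nbhs_ballP[e e0 eB]; have [M M0 NM] := seminorm_le sN.
apply/nbhs_ballP; exists (e / M); first exact: divr_gt0.
move=> y xy; apply: eB; move: xy; rewrite -!ball_normE /=.
rewrite ltr_pdivlMr// mulrC => xy.
exact: le_lt_trans (fN _ _) (le_lt_trans (NM _) xy).
Qed.

Lemma seminorm_continuous N z :
  is_seminorm N -> continuous (fun x => N (x - z)).
Proof.
move=> sN; apply: seminorm_lipschitz_continuous (sN) _ => x y.
by apply: le_trans (seminorm_dist _ _ sN) _; rewrite opprB addrA subrK.
Qed.

(** The constant is the minimum of [N] on the sup-norm unit sphere, positive since [N] vanishes only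
    at 0. The sphere is empty when n = 0, hence the separate case. *)
Lemma norm_ge N : is_norm N -> exists2 c, 0 < c & forall x, c * `|x| <= N x.
Proof.
move=> nN; have sN := is_norm_seminorm nN; have [_ hN N0] := nN.
pose S := [set x : 'cV[R]_n | `|x| = 1].
have unit_S x : x != 0 -> S (`|x|^-1 *: x).
  by move=> x0; rewrite /S/= normrZ normfV normr_id mulVf// normr_eq0.
have [S0|/set0P/negP/negPn/eqP S0] := pselect (S !=set0); last first.
  exists 1 => // x; have [->|/unit_S] := eqVneq x 0; last by rewrite S0.
  by rewrite normr0 mulr0 seminorm0.
have cN : continuous N.
  by apply: seminorm_lipschitz_continuous (sN) _ => x y; exact: seminorm_dist.
have [|c] := compact_EVT_min S0 _ (continuous_subspaceT cN).
  apply: bounded_closed_compact_cV.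
    by exists 1; split=> // a a1 x /= ->; exact: ltW.
  rewrite (_ : S = Num.norm @^-1` [set 1])//.
  apply: preimage_closed; first by move=> x _; exact: norm_continuous.
  exact: closed_eq.
rewrite inE => Sc cmin; exists (N c).
  rewrite lt_neqAle seminorm_ge0// andbT eq_sym; apply/eqP => /N0 c0.
  by move: Sc; rewrite /S/= c0 normr0 => /eqP; rewrite eq_sym oner_eq0.
move=> x; have [->|x0] := eqVneq x 0; first by rewrite normr0 mulr0 seminorm0.
have := cmin _ (mem_set (unit_S _ x0)); rewrite hN normfV normr_id.
by rewrite ler_pdivlMl ?normr_gt0// mulrC.
Qed.

Lemma norm_bounded_EVT_min N (S : set 'cV[R]_n) z M (f : 'cV[R]_n -> R) :
  is_norm N -> closed S -> S !=set0 -> (forall x, S x -> N (x - z) <= M) ->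
  continuous f -> exists2 x, S x & forall y, S y -> f x <= f y.
Proof.
move=> nN Scl S0 SM cf; have [c c0 Nc] := norm_ge nN.
have [tN _ _] := nN.
have Sb : bounded_set S.
  exists ((M + N z) / c); split=> [|a aM x Sx /=]; first exact: num_real.
  apply: le_trans (ltW aM); rewrite ler_pdivlMr// mulrC.
  apply: le_trans (Nc _) _; rewrite -[x in N x](subrK z).
  by apply: le_trans (tN _ _) _; rewrite lerD2r SM.
have [x Sx xmin] := compact_EVT_min S0 (bounded_closed_compact_cV Sb Scl)
  (continuous_subspaceT cf).
by exists x => [|y Sy]; [exact: set_mem|exact/xmin/mem_set].
Qed.

End Norms.

(** * Minimal members of finite families of sets *)

Section FiniteFamilies.
Variables (T : Type) (I : finType) (c : I -> set T) (P : set (set T)).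
Hypothesis P_range : P `<=` range c.

(** Induction on the number of indices whose set lies inside [C]: a strictly smaller member of [P]
    has fewer of them. *)
Lemma finite_minimal_subset C : P C ->
  exists C', [/\ P C', C' `<=` C
    & forall C'', P C'' -> C'' `<=` C' -> C'' = C'].
Proof.
pose below C := [set i | `[< c i `<=` C >]]%SET.
have [k] := ubnP #|below C|; elim: k C => // k ih C /ltnSE-Ck PC.
have [Cmin|] := pselect (forall C'', P C'' -> C'' `<=` C -> C'' = C).
  by exists C; split.
move=> /existsNP[C1 /not_implyP[PC1 /not_implyP[C1C neC]]].
suff /ih/(_ PC1)[C' [PC' C'C1 C'min]] : (#|below C1| < k)%N.
  by exists C'; split=> //; exact: subset_trans C1C.
apply: leq_trans Ck; apply: proper_card; apply/properP; split.
  apply/fintype.subsetP => i; rewrite !finset.inE => /asboolP ciC1.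
  by apply/asboolP => t /ciC1/C1C.
have [i _ ciC] := P_range PC; exists i; rewrite !finset.inE ciC.
  exact/asboolP.
by apply/asboolP => CC1; apply: neC; exact/seteqP.
Qed.

Lemma finite_image_is_min (R : realType) (F : set T -> \bar R) : P !=set0 ->
  exists z, is_min [set F C | C in P] z.
Proof.
case=> C PC; have [i _ ciC] := P_range PC.
have Pi : `[< P (c i) >] by apply/asboolP; rewrite ciC.
case: (@arg_minP _ _ I i (fun i => `[< P (c i) >]) (F \o c) Pi).
move=> j /asboolP Pj jmin.
exists (F (c j)); split; first by exists (c j).
move=> _ [C' PC' <-]; have [l _ clC'] := P_range PC'.
by rewrite -clC'; apply: jmin; apply/asboolP; rewrite clC'.
Qed.

End FiniteFamilies.

(** * Tangent cones and internal points of convex sets *)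

Section ConvexSets.
Variables (R : realType) (n : nat).
Implicit Types (X : set 'cV[R]_n) (x y z d : 'cV[R]_n).

Definition convex_closed X : Prop := forall x y (t : R),
  X x -> X y -> 0 <= t <= 1 -> X ((1 - t) *: x + t *: y).

(** For convex [X] this is the relative interior, in a topology-free form that passes directly to
    linear images. *)
Definition internal X z : Prop :=
  X z /\ forall x, X x -> exists2 s : R, 0 < s & X (z + s *: (z - x)).

Lemma tangent_cone_sub X x z : X x -> tangent_cone X z (x - z).
Proof. by move=> Xx; exists 1; rewrite // scale1r addrC subrK. Qed.

Lemma tangent_cone0 X z : X z -> tangent_cone X z 0.
Proof. by move=> Xz; rewrite -(subrr z); exact: tangent_cone_sub. Qed.

Lemma tangent_coneZ X z d (a : R) : X z -> 0 <= a ->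
  tangent_cone X z d -> tangent_cone X z (a *: d).
Proof.
move=> Xz; rewrite le_eqVlt => /orP[/eqP<- _|a0 [t t0 Xt]].
  by rewrite scale0r; exact: tangent_cone0.
by exists (t / a); rewrite ?divr_gt0// scalerA divfK// gt_eqF.
Qed.

Lemma tangent_coneD X z d e : convex_closed X ->
  tangent_cone X z d -> tangent_cone X z e -> tangent_cone X z (d + e).
Proof.
move=> cX [t t0 Xt] [s s0 Xs].
have ts0 : 0 < t + s by rewrite addr_gt0.
(* The new point is the convex combination of [z + t *: d] and [z + s *: e] with weights s/(t+s) and
   t/(t+s). *)
exists (t * s / (t + s)); first by rewrite divr_gt0// mulr_gt0.
have := cX _ _ (t / (t + s)) Xt Xs.
rewrite (divr_ge0 (ltW t0) (ltW ts0))/= ler_pdivrMr// mul1r lerDl (ltW s0).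
move=> /(_ isT).
congr X; apply/matrixP => i j; rewrite !mxE; field.
by rewrite gt_eqF.
Qed.

Lemma tangent_cone_small X z d : convex_closed X -> X z ->
  tangent_cone X z d -> exists2 t : R, 0 < t <= 1 & X (z + t *: d).
Proof.
move=> cX Xz [t t0 Xt]; have t1 : 0 < 1 + t by rewrite ltr_pwDl// ltW.
exists (t / (1 + t)).
  by rewrite divr_gt0//= ler_pdivrMr// mul1r lerDr.
have := cX _ _ (1 + t)^-1 Xz Xt.
rewrite invr_ge0 (ltW t1)/= invf_le1// lerDl (ltW t0) => /(_ isT).
congr X; apply/matrixP => i j; rewrite !mxE; field.
by rewrite gt_eqF.
Qed.

(** Given [x], prolong its segment to [x0] beyond [x0], then join the endpoint to [y]: this last
    segment meets the ray from [x] through the given point beyond that point. *)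
Lemma internal_segment X x0 y (e : R) : convex_closed X -> internal X x0 ->
  X y -> 0 < e <= 1 -> internal X ((1 - e) *: y + e *: x0).
Proof.
move=> cX [Xx0 x0X] Xy /andP[e0 e1].
split=> [|x Xx]; first by apply: cX => //; rewrite ltW.
have [s s0 Xs] := x0X _ Xx.
have se0 : 0 <= s * (1 - e) by rewrite mulr_ge0 ?subr_ge0// ltW.
have d0 : 0 < 1 + s * (1 - e) by rewrite ltr_pwDl.
exists (e * s / (1 + s * (1 - e))); first by rewrite divr_gt0// mulr_gt0.
have le1 : e / (1 + s * (1 - e)) <= 1.
  by rewrite ler_pdivrMr// mul1r (le_trans e1)// lerDl.
have := cX _ _ (e / (1 + s * (1 - e))) Xy Xs.
rewrite (divr_ge0 (ltW e0) (ltW d0))/= le1 => /(_ isT).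
congr X; apply/matrixP => i j; rewrite !mxE; field.
by rewrite gt_eqF.
Qed.

End ConvexSets.

(** * Linear images of tangent cones *)

Section TangentImages.
Variables (R : realType) (m n : nat) (A : 'M[R]_(m, n)) (X : set 'cV[R]_n).
Hypothesis X_convex : convex_closed X.
Implicit Types (x y z : 'cV[R]_n).

(** Only negative multiples are at issue. Prolonging the segment from A(z + td) to A z beyond A z
    yields [w] in [X] with A(w - z) = -st A d. *)
Lemma tangent_cone_linear_image z : X z -> internal (mulmx A @` X) (A *m z) ->
  linear_subspace (mulmx A @` tangent_cone X z).
Proof.
move=> Xz [_ Az]; split=> [|a _ _ [d dT <-] [e eT <-]].
  by exists 0; [exact: tangent_cone0|rewrite mulmx0].
have [a0|a0] := leP 0 a.
  exists (a *: d + e); last by rewrite mulmxDr scalemxAr.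
  by apply: tangent_coneD => //; exact: tangent_coneZ.
have [t t0 Xt] := dT.
have [s s0 [w Xw Aw]] := Az _ (imageP (mulmx A) Xt).
exists ((- a / (s * t)) *: (w - z) + e).
  apply: tangent_coneD => //; apply: tangent_coneZ => //.
    by rewrite divr_ge0 ?oppr_ge0 ?ltW// mulr_gt0.
  exact: tangent_cone_sub.
rewrite mulmxDr -scalemxAr mulmxBr Aw mulmxDr -scalemxAr; congr (_ + _).
apply/matrixP => i j; rewrite !mxE; field.
by rewrite !gt_eqF.
Qed.

(** Both x - z and y - z are tangent at [z], and linearity of the image allows the sign of the first
    to be reversed. *)
Lemma tangent_cone_linear_image_sub x y z : X x -> X y -> X z ->
  linear_subspace (mulmx A @` tangent_cone X z) ->
  (mulmx A @` tangent_cone X z) (A *m (y - x)).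
Proof.
move=> Xx Xy Xz [_ linA].
have -> : A *m (y - x) = -1 *: (A *m (x - z)) + A *m (y - z).
  by rewrite scaleN1r !mulmxBr opprB [RHS]addrC addrA subrK.
by apply: linA; apply: imageP; exact: tangent_cone_sub.
Qed.

Lemma internal_image z : internal X z -> internal (mulmx A @` X) (A *m z).
Proof.
move=> [Xz zX]; split=> [|_ [x Xx <-]]; first exact: imageP.
have [s s0 Xs] := zX _ Xx; exists s => //.
by exists (z + s *: (z - x)); rewrite // mulmxDr -scalemxAr mulmxBr.
Qed.

End TangentImages.

(** * Polyhedra: active constraints, internal points, closedness *)

Section Polyhedra.
Variables (R : realType) (n k : nat) (B : 'M[R]_(k, n)) (b : 'cV[R]_k).
Implicit Types (x y z d : 'cV[R]_n).

Definition halfspaces : set 'cV[R]_n :=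
  [set x | forall i, (B *m x) i 0 <= b i 0].
Local Notation X := halfspaces.

Lemma row_ray z d t i :
  (B *m (z + t *: d)) i 0 = (B *m z) i 0 + t * (B *m d) i 0.
Proof. by rewrite mulmxDr -scalemxAr !mxE. Qed.

Lemma row_combination x y s t i :
  (B *m (s *: x + t *: y)) i 0 = s * (B *m x) i 0 + t * (B *m y) i 0.
Proof. by rewrite mulmxDr -!scalemxAr !mxE. Qed.

Definition active z := [set i | (B *m z) i 0 == b i 0]%SET.

Lemma halfspaces_convex : convex_closed X.
Proof.
move=> x y t Xx Xy /andP[t0 t1] i; rewrite row_combination.
have -> : b i 0 = (1 - t) * b i 0 + t * b i 0 by ring.
by apply: lerD; apply: ler_wpM2l; rewrite ?subr_ge0.
Qed.

Lemma tangent_cone_active z : X z ->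
  tangent_cone X z = [set d | forall i, i \in active z -> (B *m d) i 0 <= 0].
Proof.
move=> Xz; apply/seteqP; split=> [d [t t0 Xt] i|d dT].
  rewrite finset.inE => /eqP zi; have := Xt i; rewrite row_ray zi.
  by rewrite gerDl pmulr_rle0.
(* [r i] is the longest step along [d] that constraint [i] allows, or 1 if [d] does not increase its
   left-hand side. *)
pose r i := if 0 < (B *m d) i 0 then (b i 0 - (B *m z) i 0) / (B *m d) i 0
            else 1.
have r0 i : 0 < r i.
  rewrite /r; case: ifPn => // di; rewrite divr_gt0// subr_gt0.
  rewrite lt_neqAle Xz andbT.
  by apply: contraTN di => zi; rewrite -leNgt dT// finset.inE.
pose t := \big[Order.min/1]_(i < k) r i.
exists t; first by apply/bigmin_gtP; split.
move=> i; rewrite row_ray.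
have t0 : 0 <= t by apply/bigmin_geP; split => // j _; exact: ltW.
have [di|di] := ltP 0 ((B *m d) i 0).
  rewrite -lerBrDl -ler_pdivlMr//.
  have ti : t <= r i by exact: bigmin_le_cond.
  by rewrite (le_trans ti)// /r di.
by rewrite -[leRHS]addr0 lerD// mulr_ge0_le0.
Qed.

(** This gives finiteness: a tangent cone is determined by its set of active constraints. *)
Lemma halfspaces_tangent_cones :
  tangent_cones X `<=`
    range (fun J : {set 'I_k} =>
      [set d | forall i, i \in J -> (B *m d) i 0 <= 0]).
Proof.
by move=> _ [z Xz <-]; exists (active z); rewrite // tangent_cone_active.
Qed.

(* A point with the fewest active constraints is internal: each constraint
   active there is active at its midpoint with any other point of X, hence
   active on all of X. *)
Lemma halfspaces_internal : X !=set0 -> exists z, internal X z.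
Proof.
move=> [x Xx].
have ex : exists j, `[< exists2 z, X z & #|active z| = j >].
  by exists #|active x|; apply/asboolP; exists x.
case: (ex_minnP ex) => j /asboolP[z Xz zj] jmin.
exists z; split=> // y Xy.
suff : tangent_cone X z (z - y) by [].
rewrite tangent_cone_active// => i iz.
pose w := (1 - 2^-1) *: z + 2^-1 *: y.
have Xw : X w by apply: halfspaces_convex => //; lra.
have wz : active w \subset active z.
  apply/fintype.subsetP => l; rewrite !finset.inE row_combination => /eqP lw.
  by rewrite eq_le Xz; have := Xy l; lra.
have /eqP aw : active w == active z.
  by rewrite eqEcard wz zj jmin//; apply/asboolP; exists w.
move: (iz); rewrite -aw finset.inE row_combination => /eqP iw.
move: iz; rewrite finset.inE => /eqP iz.
rewrite -[z - y]scale1r scalerBr -scaleNr row_combination.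
by lra.
Qed.

Lemma halfspaces_closed : closed X.
Proof.
have -> : X = \bigcap_i [set x | (B *m x) i 0 <= b i 0].
  by apply/seteqP; split=> [x Xx i _|x Xx i]; exact: Xx.
apply: closed_bigI => i _.
apply: (@preimage_closed _ _ (fun x => (B *m x) i 0) [set r | r <= b i 0]).
  2: exact: closed_le.
move=> x _.
apply: (@seminorm_lipschitz_continuous _ _ (fun d => `|(B *m d) i 0|)).
  split=> [u v|a u]; first by rewrite mulmxDr mxE ler_normD.
  by rewrite -scalemxAr mxE normrM.
by move=> u v; rewrite mulmxBr !mxE.
Qed.

End Polyhedra.

(** * The Hoffman bound *)

Section Hoffman.
Variables (R : realType) (m n k : nat).
Variables (Nn : 'cV[R]_n -> R) (Nm : 'cV[R]_m -> R).
Hypotheses (NnP : is_norm Nn) (NmP : is_norm Nm).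
Variable A : 'M[R]_(m, n).
Implicit Types (x y z : 'cV[R]_n).

Let sNn : is_seminorm Nn := is_norm_seminorm NnP.
Let sNm : is_seminorm Nm := is_norm_seminorm NmP.

Lemma seminorm_mulmx : is_seminorm (fun x => Nm (A *m x)).
Proof.
have [tN hN] := sNm.
by split=> [x y|a x]; rewrite ?mulmxDr// -scalemxAr.
Qed.

(** Rescale [w] to unit norm, pick a near-optimal preimage and scale back. The slack [e] is there
    because the infimum need not be attained. *)
Lemma inv_norm_le_preimage (C : set 'cV[R]_n) (h e : R) w :
  C 0 -> (forall (a : R) x, 0 <= a -> C x -> C (a *: x)) ->
  (inv_norm A Nn Nm C <= h%:E)%E -> (mulmx A @` C) w -> 0 < e ->
  exists p, [/\ C p, A *m p = w & Nn p <= h * Nm w + e].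
Proof.
move=> C0 CZ Ch [d Cd <-{w}] e0.
have [_ hm N0] := NmP; have [_ hn _] := NnP.
have [Ad0|Ad0] := eqVneq (A *m d) 0.
  exists 0; rewrite Ad0 mulmx0 !seminorm0// mulr0 add0r.
  by split=> //; exact: ltW.
set r := Nm (A *m d).
have r0 : 0 < r.
  rewrite lt_neqAle seminorm_ge0// andbT eq_sym.
  by apply: contra_neq Ad0; exact: N0.
have Cv : [set v | (mulmx A @` C) v /\ Nm v <= 1] (r^-1 *: (A *m d)).
  split; last by rewrite hm gtr0_norm ?invr_gt0// mulVf// gt_eqF.
  exists (r^-1 *: d); last by rewrite scalemxAr.
  by apply: CZ => //; rewrite invr_ge0 ltW.
have : (ereal_inf
    [set (Nn x)%:E | x in [set x | C x /\ A *m x = r^-1 *: (A *m d)]]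
    < (h + e / r)%:E)%E.
  apply: (@le_lt_trans _ _ h%:E); last by rewrite lte_fin ltrDl divr_gt0.
  by apply: le_trans Ch; apply: ereal_sup_ubound; exists (r^-1 *: (A *m d)).
move=> /ereal_inf_lt[_ [x [Cx Ax] <-]]; rewrite lte_fin => xh.
exists (r *: x); split; first by apply: CZ => //; exact: ltW.
  by rewrite -scalemxAr Ax scalerA divff ?scale1r// gt_eqF.
rewrite hn gtr0_norm//; apply: (le_trans (ler_wpM2l (ltW r0) (ltW xh))).
by rewrite mulrDr mulrCA divff ?gt_eqF// mulr1 mulrC.
Qed.

Variables (B : 'M[R]_(k, n)) (b : 'cV[R]_k).
Local Notation X := (halfspaces B b).

Lemma fibre_nearest x y : X y ->
  exists z, [/\ X z, A *m z = A *m y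
    & forall z', X z' -> A *m z' = A *m y -> Nn (z - x) <= Nn (z' - x)].
Proof.
move=> Xy; have [_ _ N0] := NmP.
(* Keeping only points no farther from [x] than [y] makes the fibre compact; the fibre is written as
   a sublevel set to get closedness. *)
pose S := X `&` [set z | Nm (A *m (z - y)) <= 0]
  `&` [set z | Nn (z - x) <= Nn (y - x)].
have SE z : X z -> A *m z = A *m y -> Nn (z - x) <= Nn (y - x) -> S z.
  by move=> Xz zy zx; split=> //; split; rewrite //= mulmxBr zy subrr seminorm0.
have Scl : closed S.
  apply: closedI; first apply: closedI; first exact: halfspaces_closed.
    apply: (@preimage_closed _ _ (fun z => Nm (A *m (z - y))) [set r | r <= 0]).
      by move=> z _; exact: (seminorm_continuous seminorm_mulmx).
    exact: closed_le.
  apply: (@preimage_closed _ _ (fun z => Nn (z - x)) [set r | r <= Nn (y - x)]).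
    by move=> z _; exact: seminorm_continuous.
  exact: closed_le.
have Sy : S y by exact: SE.
have [|z [[Xz Az] _] zmin] := @norm_bounded_EVT_min _ _ _ _ x (Nn (y - x))
    _ NnP Scl (ex_intro _ y Sy) _ (seminorm_continuous (z := x) sNn).
  by move=> z [].
exists z; split=> //.
  have /N0 : Nm (A *m (z - y)) = 0 by apply/le_anti; rewrite Az seminorm_ge0.
  by rewrite mulmxBr => /eqP; rewrite subr_eq0 => /eqP.
move=> z' Xz' Az'; have [z'y|/ltW yz'] := leP (Nn (z' - x)) (Nn (y - x)).
  by apply: zmin; exact: SE.
exact: le_trans (zmin _ Sy) yz'.
Qed.

Variable h : R.
Hypothesis h_ge : forall C, minimal_tangent_cones A X C ->
  (inv_norm A Nn Nm C <= h%:E)%E.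

Lemma hoffman_internal x y : X x -> internal X y ->
  exists z, [/\ X z, A *m z = A *m y & Nn (z - x) <= h * Nm (A *m (y - x))].
Proof.
move=> Xx y_int; have [Xy _] := y_int; have cX := @halfspaces_convex R n k B b.
have [tN hN _] := NnP.
have [z [Xz Azy zmin]] := fibre_nearest x Xy; exists z; split=> //.
rewrite leNgt; apply/negP => lt_h.
have linK : linear_subspace (mulmx A @` tangent_cone X z).
  by apply: tangent_cone_linear_image => //; rewrite Azy; exact: internal_image.
(* The cone of T(A|X) inside T_X(z) is itself the tangent cone at some [z']. *)
have [_ [[[z' Xz' <-] lin' ]]] := @finite_minimal_subset _ _ _
  (fun C => tangent_cones X C /\ linear_subspace (mulmx A @` C))
  (fun C '(conj XC _) => halfspaces_tangent_cones XC) _ 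
  (conj (imageP (tangent_cone X) Xz) linK).
move=> sub' min'.
have Ch : (inv_norm A Nn Nm (tangent_cone X z') <= h%:E)%E.
  by apply: h_ge; split=> // [|C XC linC]; [exact: imageP|exact: min'].
have e0 : 0 < Nn (z - x) - h * Nm (A *m (y - x)) by rewrite subr_gt0.
(* Half of the excess as slack still leaves |p| < |z - x|. *)
have /(_ _ (divr_gt0 e0 (ltr0n _ 2)))[] := inv_norm_le_preimage
  (tangent_cone0 Xz') (fun a d => @tangent_coneZ _ _ _ _ d a Xz') Ch
  (tangent_cone_linear_image_sub Xx Xy Xz' lin') => //.
move=> p [/sub' Kp Ap ple].
have /(tangent_cone_small cX Xz)[t /andP[t0 t1] Xt] :
    tangent_cone X z ((x - z) + p).
  by apply: tangent_coneD => //; exact: tangent_cone_sub.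
(* Since A p = A(y - x) and A z = A y, the direction (x - z) + p lies in ker A and the moved point
   stays in the fibre. *)
have := zmin _ Xt; rewrite mulmxDr -scalemxAr mulmxDr Ap !mulmxBr Azy.
rewrite addrA subrK subrr scaler0 addr0 => /(_ erefl).
have -> : z + t *: (x - z + p) - x = (1 - t) *: (z - x) + t *: p.
  by apply/matrixP => i j; rewrite !mxE; ring.
(* The new distance is at most (1 - t)|z - x| + t|p| < |z - x|, contradicting the choice of [z]. *)
have := tN ((1 - t) *: (z - x)) (t *: p).
rewrite !hN ger0_norm ?subr_ge0// gtr0_norm//.
by nra.
Qed.

Lemma hoffman x y : 0 <= h -> X x -> X y ->
  exists z, [/\ X z, A *m z = A *m y & Nn (z - x) <= h * Nm (A *m (y - x))].
Proof.
move=> h0 Xx Xy; have cX := @halfspaces_convex R n k B b.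
have [tN hN _] := NnP; have [tm hm N0] := NmP.
have [x0 x0_int] : exists x0, internal X x0.
  by apply: halfspaces_internal; exists x.
have Xx0 := x0_int.1.
pose w := h * Nm (A *m (y - x)).
(* Contracting by [e] moves [x] by e(x0 - x), so this radius accommodates the points found for every
   [e] up to 1. *)
pose S := X `&` [set z | Nn (z - x) <= w + Nn (x0 - x)].
(* F vanishes exactly at the points sought, and is O(e) at those provided for
   the contracted pair. *)
pose F z := Nm (A *m (z - y)) + Num.max 0 (Nn (z - x) - w).
have near_z e : 0 < e <= 1 ->
    exists2 z, S z & F z <= e * (Nm (A *m (x0 - y)) + Nn (x0 - x)).
  move=> /[dup] e01 /andP[e0 e1].
  pose shrink u := (1 - e) *: u + e *: x0.
  have Xshrink u : X u -> X (shrink u).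
    by move=> Xu; apply: cX => //; rewrite ltW.
  have [z [Xz Az zle]] := hoffman_internal (Xshrink _ Xx)
    (internal_segment cX x0_int Xy e01).
  have le1 : Nn (z - x) - w <= e * Nn (x0 - x).
    have -> : z - x = (z - shrink x) + e *: (x0 - x).
      by apply/matrixP => i j; rewrite !mxE; ring.
    rewrite lerBlDr; apply: (le_trans (tN _ _)).
    rewrite hN gtr0_norm// addrC lerD2l (le_trans zle)// ler_wpM2l//.
    have -> : shrink y - shrink x = (1 - e) *: (y - x).
      by apply/matrixP => i j; rewrite !mxE; ring.
    rewrite -scalemxAr hm ger0_norm ?subr_ge0// ler_piMl ?seminorm_ge0//.
    by rewrite gerBl ltW.
  exists z.
    split=> //=; rewrite -lerBlDl; apply: le_trans le1 _.
    by rewrite ler_piMl// seminorm_ge0.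
  rewrite /F mulrDr; apply: lerD.
    have -> : A *m (z - y) = e *: (A *m (x0 - y)).
      rewrite mulmxBr Az -mulmxBr scalemxAr; congr (A *m _).
      by apply/matrixP => i j; rewrite !mxE; ring.
    by rewrite hm gtr0_norm.
  by rewrite ge_max le1 mulr_ge0 ?seminorm_ge0// ltW.
have Scl : closed S.
  apply: closedI; first exact: halfspaces_closed.
  apply: (@preimage_closed _ _ (fun z => Nn (z - x))
    [set r | r <= w + Nn (x0 - x)]).
    by move=> z _; exact: seminorm_continuous.
  exact: closed_le.
(* Both terms of [F] are controlled by one seminorm: each of them is 1-Lipschitz for its own
   summand. *)
have cF : continuous F.
  have dF : is_seminorm (fun u => Nm (A *m u) + Nn u).
    split=> [u v|a u]; last by rewrite -scalemxAr hm hN mulrDr.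
    by rewrite mulmxDr addrACA lerD.
  apply: (seminorm_lipschitz_continuous dF) => u v.
  have := seminorm_dist (u - y) (v - y) seminorm_mulmx.
  have := seminorm_dist (u - x) (v - x) sNn.
  have sub_sub (c : 'cV[R]_n) : u - c - (v - c) = u - v.
    by rewrite opprB addrA subrK.
  rewrite !sub_sub /F !ler_norml => /andP[? ?] /andP[? ?].
  by apply/andP; split; rewrite /Num.max; do 2 case: ifPn => [?|/negbTE ?]; lra.
have [|z1 Sz1 _] := near_z 1; first by rewrite ltr01 lexx.
have [|z [Xz _] zmin] := @norm_bounded_EVT_min _ _ _ _ x (w + Nn (x0 - x))
    _ NnP Scl (ex_intro _ z1 Sz1) _ cF.
  by move=> z [].
have Fz : F z <= 0.
  apply/ler_addgt0Pr => e e0; rewrite add0r.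
  pose K := Nm (A *m (x0 - y)) + Nn (x0 - x).
  have K0 : 0 <= K by rewrite addr_ge0 ?seminorm_ge0.
  have K1 : 0 < 1 + K + e by rewrite addr_gt0// ltr_pwDl.
  (* The denominator makes the contraction factor at most 1 and its product with [K] at most [e]. *)
  have e'01 : 0 < e / (1 + K + e) <= 1.
    by rewrite divr_gt0//= ler_pdivrMr// mul1r lerDr addr_ge0.
  have [z' Sz' Fz'] := near_z _ e'01.
  apply: le_trans (zmin _ Sz') _; apply: le_trans Fz' _; rewrite -/K.
  by rewrite mulrAC ler_pdivrMr// ler_wpM2l ?ltW//; lra.
have max0 : 0 <= Num.max 0 (Nn (z - x) - w) by rewrite le_max lexx.
have maxw : Nn (z - x) - w <= Num.max 0 (Nn (z - x) - w).
  by rewrite le_max lexx orbT.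
have Nm0 : 0 <= Nm (A *m (z - y)) by exact: seminorm_ge0.
exists z; split=> //; last by move: Fz; rewrite /F -/w; lra.
have /N0 : Nm (A *m (z - y)) = 0 by move: Fz; rewrite /F; lra.
by rewrite mulmxBr => /eqP; rewrite subr_eq0 => /eqP.
Qed.

End Hoffman.

(** * Gradients and Bregman distances under composition with a matrix *)

Lemma dotBl (R : realType) n (u v w : 'cV[R]_n) :
  dot (u - v) w = dot u w - dot v w.
Proof. by rewrite /dot linearB/= mulmxBl !mxE. Qed.

Lemma dotNr (R : realType) n (u w : 'cV[R]_n) : dot u (- w) = - dot u w.
Proof. by rewrite /dot mulmxN mxE. Qed.

Lemma dot_sum (R : realType) n (u w : 'cV[R]_n) :
  dot u w = \sum_i u i 0 * w i 0.
Proof. by rewrite /dot mxE; apply: eq_bigr => i _; rewrite mxE. Qed.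

Section BregmanComposition.
Variables (R : realType) (m : nat) (g : 'cV[R]_m -> \bar R).
Implicit Types (u v w : 'cV[R]_m).

Lemma dot_grad u w : differentiable (fine \o g) u ->
  dot (grad g u) w = 'D_w (fine \o g) u.
Proof.
move=> dg; rewrite deriveE// dot_sum [X in 'd _ _ X]matrix_sum_delta linear_sum.
by apply: eq_bigr => i _; rewrite big_ord1 linearZ/= mxE deriveE// mulrC.
Qed.

Lemma derive_comp_mulmx n (A : 'M[R]_(m, n)) (x d : 'cV[R]_n) :
  'D_d (fine \o (g \o mulmx A)) x = 'D_(A *m d) (fine \o g) (A *m x).
Proof.
rewrite /derive; set F := (fun _ : R => _); set G := (fun _ : R => _).
suff -> : F = G by [].
by apply/funext => t; rewrite /F /G /= mulmxDr -scalemxAr.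
Qed.

(** A partial derivative of the composite is the derivative of [g] along a column of [A]; linearity
    of the differential of [g] sums them. *)
Lemma dot_grad_comp n (A : 'M[R]_(m, n)) (x d : 'cV[R]_n) :
  differentiable (fine \o g) (A *m x) ->
  dot (grad (g \o mulmx A) x) d = dot (grad g (A *m x)) (A *m d).
Proof.
move=> dg; rewrite dot_grad// deriveE//.
rewrite dot_sum [X in 'd _ _ (A *m X)]matrix_sum_delta mulmx_sumr linear_sum.
apply: eq_bigr => i _; rewrite big_ord1 -scalemxAr linearZ/= mxE mulrC.
by rewrite derive_comp_mulmx deriveE.
Qed.

Lemma bregman_comp n (A : 'M[R]_(m, n)) (x y : 'cV[R]_n) :
  differentiable (fine \o g) (A *m x) ->
  bregman (g \o mulmx A) y x = bregman g (A *m y) (A *m x).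
Proof. by move=> dg; rewrite /bregman dot_grad_comp// mulmxBr. Qed.

(** Add the strong convexity inequalities for (u, v) and (v, u): the values of [g], being finite,
    cancel, and the two halves of [mu] add up. *)
Lemma strongly_convex_monotone Nm mu u v : strongly_convex Nm g mu ->
  is_norm Nm -> (forall w, (-oo < g w)%E) -> edom g u -> edom g v ->
  mu * Nm (u - v) ^+ 2 <= dot (grad g u - grad g v) (u - v).
Proof.
move=> [_ gmu] NmP g_gtNy gu gv.
have gfin w : edom g w -> g w = (fine (g w))%:E.
  by move=> gw; rewrite fineK// fin_real// g_gtNy.
have := gmu _ _ gu gv; have := gmu _ _ gv gu.
rewrite /bregman (gfin _ gu) (gfin _ gv) -!EFinB !lee_fin.
rewrite (seminormBC v u (is_norm_seminorm NmP)) dotBl -(opprB u v) dotNr.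
by lra.
Qed.

End BregmanComposition.

(** * From the Hoffman bound to the relative constant *)

Lemma le_div_sqre (R : realType) (mu r : R) (I : \bar R) : 0 < r -> 0 <= mu ->
  (r%:E <= mu%:E / I ^+ 2)%E -> (I <= (Num.sqrt (mu / r))%:E)%E.
Proof.
move=> r0 mu0; case: I => [i| |]; last 2 first.
(* At +oo the quotient is 0, which the positive [r] excludes. *)
- by rewrite expe2 mulyy invey mule0 lee_fin leNgt r0.
- by rewrite leNye.
rewrite -EFin_expe lee_fin => ri; rewrite leNgt; apply/negP => lt_i.
have i0 : 0 < i by apply: le_lt_trans lt_i; exact: sqrtr_ge0.
have i20 : 0 < i ^+ 2 by rewrite exprn_gt0.
move: ri; rewrite inver gt_eqF// -EFinM lee_fin ler_pdivlMr//.
apply/negP; rewrite -ltNge mulrC -ltr_pdivrMr//.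
rewrite -(sqr_sqrtr (divr_ge0 mu0 (ltW r0))) ltr_pXn2r// nnegrE.
  exact: sqrtr_ge0.
exact: ltW.
Qed.

Section MainBound.
Variables (R : realType) (m n k : nat).
Variables (Nn : 'cV[R]_n -> R) (Nm : 'cV[R]_m -> R).
Hypotheses (NnP : is_norm Nn) (NmP : is_norm Nm).
Variables (A : 'M[R]_(m, n)) (g : 'cV[R]_m -> \bar R).
Hypotheses (g_gtNy : forall u, (-oo < g u)%E) (g_diff : edifferentiable g).
Variable mu : R.
Hypothesis g_strong : strongly_convex Nm g mu.
Local Notation f := (g \o mulmx A).

(** The orthogonality condition reads as one on [grad g] at A z and A y, where strong monotonicity
    forces A z = A y. *)
Lemma Zset_fibre (X : set 'cV[R]_n) y : X `<=` edom f -> X y ->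
  Zset f X y = [set z | X z /\ A *m z = A *m y].
Proof.
move=> X_dom Xy; have [mu0 _] := g_strong; have [_ _ N0] := NmP.
have dg z : X z -> differentiable (fine \o g) (A *m z).
  by move=> Xz; have [] := g_diff (X_dom _ Xz).
apply/seteqP; split=> [z [Xz _]|z [Xz Azy]]; last first.
  split=> //=; first by rewrite Azy.
  rewrite dotBl !dot_grad_comp; [|exact: dg|exact: dg].
  by rewrite Azy subrr.
rewrite dotBl !dot_grad_comp; [|exact: dg|exact: dg].
rewrite -dotBl mulmxBr => dot0; split=> //.
have := strongly_convex_monotone g_strong NmP g_gtNy (X_dom _ Xz) (X_dom _ Xy).
rewrite dot0 pmulr_rle0// => N2.
have /eqP : Nm (A *m z - A *m y) ^+ 2 = 0 by apply/le_anti; rewrite N2 sqr_ge0.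
by rewrite sqrf_eq0 => /eqP/N0/eqP; rewrite subr_eq0 => /eqP.
Qed.

Lemma bregman_set_ge (X : set 'cV[R]_n) x y : X `<=` edom f -> X x -> X y ->
  ((mu / 2 * Nm (A *m (y - x)) ^+ 2)%:E <= bregman_set f (Zset f X y) x)%E.
Proof.
move=> X_dom Xx Xy; have [_ gmu] := g_strong.
apply: le_ereal_inf_tmp => _ [z + <-]; rewrite Zset_fibre// => -[Xz Azy].
rewrite bregman_comp; last by have [] := g_diff (X_dom _ Xx).
by rewrite mulmxBr -Azy; apply: gmu; exact: X_dom.
Qed.

Variables (B : 'M[R]_(k, n)) (b : 'cV[R]_k).
Local Notation X := (halfspaces B b).
Hypothesis X_dom : X `<=` edom f.
Variable D : 'cV[R]_n -> 'cV[R]_n -> R.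
Hypothesis D_le : forall x y, X x -> X y -> D x y <= 2^-1 * Nn (x - y) ^+ 2.

Lemma dist_set_le_bregman_set (r : R) x y : 0 < r ->
  (forall C, minimal_tangent_cones A X C ->
     (r%:E <= mu%:E / (inv_norm A Nn Nm C) ^+ 2)%E) ->
  X x -> X y ->
  (r%:E * dist_set D (Zset f X y) x <= bregman_set f (Zset f X y) x)%E.
Proof.
move=> r0 rC Xx Xy; have [mu0 _] := g_strong.
(* The Hoffman constant is h = sqrt(mu/r), so that r h^2 / 2 = mu / 2 matches the lower bound on the
   Bregman distance. *)
have h_ge C : minimal_tangent_cones A X C ->
    (inv_norm A Nn Nm C <= (Num.sqrt (mu / r))%:E)%E.
  by move=> /rC; apply: le_div_sqre => //; exact: ltW.
have [z [Xz Azy zle]] := hoffman NnP NmP h_ge (sqrtr_ge0 _) Xx Xy.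
apply: le_trans (bregman_set_ge X_dom Xx Xy).
apply: (@le_trans _ _ (r%:E * (2^-1 * Nn (z - x) ^+ 2)%:E)%E).
  apply: lee_wpmul2l; first by rewrite lee_fin ltW.
  apply: (@le_trans _ _ (D z x)%:E); last by rewrite lee_fin D_le.
  by apply: ereal_inf_lbound; exists z => //; rewrite Zset_fibre.
rewrite -EFinM lee_fin.
have : Nn (z - x) ^+ 2 <= mu / r * Nm (A *m (y - x)) ^+ 2.
  rewrite -(sqr_sqrtr (divr_ge0 (ltW mu0) (ltW r0))) -exprMn ler_pXn2r// nnegrE.
    exact: seminorm_ge0 (is_norm_seminorm NnP).
  by rewrite mulr_ge0 ?sqrtr_ge0//; exact: seminorm_ge0 (is_norm_seminorm NmP).
rewrite mulrAC ler_pdivlMr// => le_mu.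
by lra.
Qed.

(** At an internal point the tangent cone has a linear image; a minimal such cone lies below it. *)
Lemma minimal_tangent_cones_neq0 : X !=set0 -> minimal_tangent_cones A X !=set0.
Proof.
move=> X0; have cX := @halfspaces_convex R n k B b.
have [z z_int] := halfspaces_internal X0.
have linK : linear_subspace (mulmx A @` tangent_cone X z).
  by apply: tangent_cone_linear_image z_int.1 _ => //; exact: internal_image.
have [C [[XC linC] _ Cmin]] := @finite_minimal_subset _ _ _
  (fun C => tangent_cones X C /\ linear_subspace (mulmx A @` C))
  (fun C '(conj XC _) => halfspaces_tangent_cones XC) _
  (conj (imageP (tangent_cone X) z_int.1) linK).
by exists C; split=> // C' XC' linC'; exact: Cmin.
Qed.

End MainBound.

Theorem theorem2 (R : realType) (m n : nat)
    (Nn : 'cV[R]_n -> R) (Nm : 'cV[R]_m -> R)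
    (NnP : is_norm Nn) (NmP : is_norm Nm)
    (A : 'M[R]_(m, n))
    (g : 'cV[R]_m -> \bar R)
    (g_gtNy : forall u, (-oo < g u)%E)
    (g_convex : econvex g) (g_diff : edifferentiable g)
    (f : 'cV[R]_n -> \bar R) (fE : f = g \o mulmx A)
    (X : set 'cV[R]_n) (X_poly : polyhedron X) (X_dom : X `<=` edom f)
    (AX_points : exists u v,
       [/\ (mulmx A @` X) u, (mulmx A @` X) v & u <> v])
    (D : 'cV[R]_n -> 'cV[R]_n -> R) (D_dist : distance_like X D)
    (D_le : forall x y, X x -> X y -> D x y <= 2^-1 * Nn (x - y) ^+ 2)
    (mu_g : R) (g_strong : strongly_convex Nm g mu_g) :
  exists2 c : \bar R,
    is_min [set (mu_g%:E / (inv_norm A Nn Nm C) ^+ 2)%E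
           | C in minimal_tangent_cones A X] c
    & (c <= rel_strong_convexity f X D)%E.
Proof.
have [k [B [b XE]]] := X_poly; change (X = halfspaces B b) in XE; subst X f.
have X0 : halfspaces B b !=set0.
  by have [_ [_ [[x Xx _] _ _]]] := AX_points; exists x.
have [c c_min] := @finite_image_is_min _ _ _
  (minimal_tangent_cones A (halfspaces B b))
  (fun C '(And3 XC _ _) => halfspaces_tangent_cones XC) R
  (fun C => mu_g%:E / (inv_norm A Nn Nm C) ^+ 2)%E
  (minimal_tangent_cones_neq0 A X0).
exists c => //; have [mu0 _] := g_strong.
(* Every positive real below the minimum is an admissible constant; working with reals also covers
   an infinite minimum. *)
have le_sup r : 0 < r -> (r%:E <= c)%E ->
    (r%:E <= rel_strong_convexity (g \o mulmx A) (halfspaces B b) D)%E.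
  move=> r0 rc; apply: ereal_sup_ubound; exists r => //.
  split=> [|x y Xx Xy]; first exact: ltW.
  apply: (dist_set_le_bregman_set NnP NmP g_gtNy g_diff g_strong X_dom D_le
    r0 _ Xx Xy) => C C_min.
  by apply: le_trans rc _; apply: c_min.2; exists C.
have sup_ge0 :
    (0%:E <= rel_strong_convexity (g \o mulmx A) (halfspaces B b) D)%E.
  apply: ereal_sup_ubound; exists 0 => //; split=> // x y Xx Xy.
  rewrite mul0e.
  apply: le_trans (bregman_set_ge NmP g_gtNy g_diff g_strong X_dom Xx Xy).
  by rewrite lee_fin mulr_ge0 ?sqr_ge0// divr_ge0// ltW.
(* If the minimum is +oo, every positive real is admissible and the supremum is +oo as well. *)
case: c le_sup {c_min} => [r le_sup| le_sup|_]; last by rewrite leNye.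
  have [r0|r0] := ltP 0 r; first exact: le_sup.
  by apply: le_trans sup_ge0; rewrite lee_fin.
rewrite leye_eq; apply/eqP/eqyP => r r0.
by apply: le_sup => //; rewrite leey.
Qed.
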